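(* Let $n,K\ge 1$ be integers, let $\pi_1,\dots,\pi_K>0$ with $\sum_{c=1}^K\pi_c=1$, and let $f_1,\dots,f_K$ be probability densities on $\mathbb{R}^n$ with $\int_{\mathbb{R}^n} f_c^2\,dx<\infty$ and finite differential entropy $h(f_c)$. Let $C$ be a random variable on $\{1,\dots,K\}$ with $\mathbb{P}(C=c)=\pi_c$, and let $X\in\mathbb{R}^n$ have conditional density $f_c$ given $C=c$, so that $X$ has density $p_X(x)=\sum_{c=1}^K\pi_c f_c(x)$. Assume that each $f_c$ belongs to a family $\mathcal{F}_c$ of densities on $\mathbb{R}^n$ on which the gap $\Delta(f)=h(f)-h_2(f)$ is constant (i.e. it depends only on the family and on the dimension $n$, not on location/scale parameters). Put $$\Delta_c=\Delta(f_c),\qquad \bar\Delta=\sum_{c=1}^K\pi_c\Delta_c,\qquad \hat h(X)=h_{\mathsf L}(X)+\bar\Delta,$$ where $h_{\mathsf L}(X)=-\sum_{c=1}^K\pi_c\log_2\big(\sum_{d=1}^K\pi_d z_{c,d}\big)$ and $z_{c,d}=\int_{\mathbb{R}^n}f_c(x)f_d(x)\,dx$. Then: 1. (Complete-overlap exactness) If $f_1=\cdots=f_K=f$, then $\hat h(X)=h(f)=h(X)$. 2. (Zero-overlap exactness) If $z_{c,d}=0$ for all $c\neq d$, then $\hat h(X)=h(X\mid C)+H(C)$. 3. (Family constants) The gap takes the following values: $$\Delta_c=\begin{cases}\dfrac n2\log_2\!\big(\tfrac e2\big), & f_c\text{ Gaussian on }\mathbb{R}^n,\\[1ex] n\log_2\!\big(\tfrac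 e2\big), & f_c\text{ factorized Laplacian on }\mathbb{R}^n,\\[1ex] 0, & f_c\text{ uniform on a measurable set}.\end{cases}$$
   Context: For a probability density $f$ on $\mathbb{R}^n$, the differential entropy (in bits) is $h(f)=-\int_{\mathbb{R}^n}f(x)\log_2 f(x)\,dx$ with $0\log_2 0=0$, and the R\'enyi-2 (collision) entropy is $h_2(f)=-\log_2\int_{\mathbb{R}^n}f(x)^2\,dx$. We write $h(X)=h(p_X)$, $h(X\mid C)=\sum_{c=1}^K\pi_c h(f_c)$ and $H(C)=-\sum_{c=1}^K\pi_c\log_2\pi_c$. Families: ''Gaussian on $\mathbb{R}^n$'' means the density of $\mathcal{N}(\mu,\Sigma)$ with $\mu\in\mathbb{R}^n$ and $\Sigma$ symmetric positive definite. ''Factorized Laplacian on $\mathbb{R}^n$'' means $f(x)=\prod_{i=1}^n\frac{1}{2b_i}\exp(-|x_i-\mu_i|/b_i)$ with $\mu\in\mathbb{R}^n$ and all $b_i>0$. ''Uniform on a measurable set'' means $f(x)=\frac{1}{|\mathcal{A}|}\mathbf{1}\{x\in\mathcal{A}\}$ for a measurable set $\mathcal{A}\subset\mathbb{R}^n$ with Lebesgue measure $0<|\mathcal{A}|<\infty$. *)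

(* Defs.v *)
From HB Require Import structures.
From mathcomp Require Import all_boot all_order all_algebra.
From mathcomp Require Import all_classical all_reals all_analysis.
Set Implicit Arguments.
Unset Strict Implicit.
Unset Printing Implicit Defensive.
Import Order.TTheory GRing.Theory Num.Theory.
Import numFieldNormedType.Exports.

Local Open Scope classical_set_scope.
Local Open Scope ring_scope.

(* R^n is n.-tuple R, whose canonical sigma-algebra is the Borel one. *)
Definition cons_pair (R : realType) (n : nat)
  (p : measurableTypeR R * n.-tuple R) : n.+1.-tuple R := cons_tuple p.1 p.2.

Lemma measurable_cons_pair (R : realType) (n : nat) :
  measurable_fun setT (@cons_pair R n).
Proof.
by apply: (@measurable_cons _ _ _ R).
Qed.

Section lebesgue_cons.
Context (R : realType) (n : nat).
Variable mu : {sigma_finite_measure set (n.-tuple R) -> \bar R}.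

Definition lebesgue_cons : set (n.+1.-tuple R) -> \bar R :=
  pushforward (lebesgue_measure \x mu)%E (@cons_pair R n).

Let lebesgue_cons0 : lebesgue_cons set0 = 0%E.
Proof. by rewrite /lebesgue_cons /pushforward preimage_set0 measure0. Qed.

Let lebesgue_cons_ge0 A : (0 <= lebesgue_cons A)%E.
Proof. exact: (measure_ge0 (lebesgue_measure \x mu)%E). Qed.

Let lebesgue_cons_sigma_additive : semi_sigma_additive lebesgue_cons.
Proof.
rewrite /lebesgue_cons; apply: measure_semi_sigma_additive.
exact: measurable_cons_pair.
Qed.

HB.instance Definition _ := isMeasure.Build _ _ _ lebesgue_cons
  lebesgue_cons0 lebesgue_cons_ge0 lebesgue_cons_sigma_additive.

Let lebesgue_cons_sigma_finite : sigma_finite setT lebesgue_cons.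
Proof.
pose g (t : n.+1.-tuple R) : measurableTypeR R * n.-tuple R :=
  (thead t, [tuple of behead t]).
have mg : measurable_fun setT g.
  apply/measurable_fun_pair; last exact: measurable_behead.
  by move=> mT Y mY; exact: (@measurable_tnth _ R n.+1 ord0).
have /sigma_finiteP[F [TF ndF Foo]] := sigma_finiteT (@lebesgue_measure R).
have /sigma_finiteP[G [TG ndG Goo]] := sigma_finiteT mu.
exists (fun k => g @^-1` (F k `*` G k)) => [|k].
  apply/esym; rewrite -subTset => t _ /=.
  have /= [i _ Fi] : (\bigcup_k F k) (thead t) by rewrite -TF.
  have /= [j _ Gj] : (\bigcup_k G k) [tuple of behead t] by rewrite -TG.
  exists (maxn i j) => //; split => /=.
  - exact: (subsetPset _ _ (ndF _ _ (leq_maxl i j))).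
  - exact: (subsetPset _ _ (ndG _ _ (leq_maxr i j))).
have [mFk Fk] := Foo k; have [mGk Gk] := Goo k; split.
  by rewrite -[X in measurable X]setTI; apply: mg => //; exact: measurableX.
rewrite /lebesgue_cons /pushforward -comp_preimage.
rewrite (_ : g \o @cons_pair R n = id).
  by rewrite preimage_id product_measure1E// lte_mul_pinfty// ge0_fin_numE.
by apply/funext => -[x t]; congr pair; exact: val_inj.
Qed.

HB.instance Definition _ := @Measure_isSigmaFinite.Build _ _ _ lebesgue_cons
  lebesgue_cons_sigma_finite.

End lebesgue_cons.

Fixpoint borel_lebesgue (R : realType) (n : nat) :
    {sigma_finite_measure set (n.-tuple R) -> \bar R} :=
  match n with
  | 0 => \d_ [tuple]
  | m.+1 => lebesgue_cons (borel_lebesgue R m)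
  end.

Lemma borel_lebesgue_box (R : realType) (n : nat) (A : 'I_n -> set R) :
  (forall i, measurable (A i)) ->
  borel_lebesgue R n [set t | forall i, A i (tnth t i)] =
  (\prod_(i < n) lebesgue_measure (A i : set (measurableTypeR R)))%E.
Proof.
elim: n A => [A _|n IHn A mA].
  rewrite big_ord0 /= diracE mem_set//= => i; by case: i.
have mB : measurable [set t : n.-tuple R | forall i, A (lift ord0 i) (tnth t i)].
  rewrite (_ : mkset _ = \bigcap_(i in [set: 'I_n])
      ((fun t : n.-tuple R => tnth t i) @^-1` A (lift ord0 i))); last first.
    by apply/seteqP; split => t /= At i; [move=> _; exact: At|exact: At].
  apply: fin_bigcap_measurable => // i _.
  by rewrite -[X in measurable X]setTI; exact: measurable_tnth.
rewrite big_ord_recl -IHn//= /lebesgue_cons /pushforward.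
rewrite -(@product_measure1E _ _ (measurableTypeR R))//; last exact: mA.
congr (product_measure1 _ _ _); apply/seteqP; split => -[x t] /= => [H|[Ax At] i].
  by split=> [|i]; [exact: (H ord0)|have := H (lift ord0 i); rewrite tnthS].
by case: (unliftP ord0 i) => [j ->|->]; [rewrite tnthS|].
Qed.

(* The same carrier as n.-tuple R, with the sigma-algebra of all
   Lebesgue-measurable sets (the Caratheodory sigma-algebra). *)
Definition Rn (R : realType) (n : nat) :=
  caratheodory_type (borel_lebesgue R n)^*%mu.

Definition lebesgue (R : realType) (n : nat) : {measure set (Rn R n) -> \bar R} :=
  @completed_measure_extension _ _ _ (borel_lebesgue R n).

Lemma measurable_Borel_Rn (R : realType) (n : nat) (A : set (n.-tuple R)) :
  measurable A -> @measurable _ (Rn R n) A.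
Proof. by move=> mA; apply: sub_caratheodory; exact: sub_sigma_algebra. Qed.

Lemma lebesgue_BorelE (R : realType) (n : nat) (A : set (n.-tuple R)) :
  measurable A -> lebesgue R n A = borel_lebesgue R n A.
Proof. exact: measurable_mu_extE. Qed.

Section entropies.
Context (R : realType) (n : nat).
Implicit Types g : Rn R n -> R.
Local Notation mu := (lebesgue R n).

Definition is_density g :=
  [/\ measurable_fun setT g, (forall x, 0 <= g x) &
      (\int[mu]_x (g x)%:E = 1)%E].

Definition log2 (x : R) : R := ln x / ln 2.

(* As ln 0 = 0, the integrand vanishes where g does. *)
Definition entropy g : R := - \int[mu]_x (g x * log2 (g x)).

Definition has_finite_entropy g :=
  mu.-integrable setT (fun x => (g x * log2 (g x))%:E).

Definition is_square_integrable g := (\int[mu]_x ((g x) ^+ 2)%:E < +oo)%E.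

Definition renyi2 g : R := - log2 (\int[mu]_x (g x) ^+ 2).

Definition gap g : R := entropy g - renyi2 g.

Definition constant_gap_family (F : set (Rn R n -> R)) :=
  (forall g, F g ->
     [/\ is_density g, is_square_integrable g & has_finite_entropy g]) /\
  (forall g1 g2, F g1 -> F g2 -> gap g1 = gap g2).

Section mixtures.
Context (K : nat).
Implicit Types (w : 'I_K -> R) (f : 'I_K -> Rn R n -> R).

Definition mixture w f : Rn R n -> R := fun x => \sum_(c < K) w c * f c x.

Definition overlap f (c d : 'I_K) : R := \int[mu]_x (f c x * f d x).

Definition overlap_entropy w f : R :=
  - \sum_(c < K) w c * log2 (\sum_(d < K) w d * overlap f c d).

Definition mean_gap w f : R := \sum_(c < K) w c * gap (f c).

Definition entropy_estimate w f : R := overlap_entropy w f + mean_gap w f.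

Definition cond_entropy w f : R := \sum_(c < K) w c * entropy (f c).

Definition label_entropy w : R := - \sum_(c < K) w c * log2 (w c).

Definition mixture_model d (Omega : measurableType d) (P : probability Omega R)
    (C : Omega -> 'I_K) (X : {RV P >-> n.-tuple R}) w f :=
  [/\ forall c, measurable (C @^-1` [set c]),
      forall c, P (C @^-1` [set c]) = (w c)%:E &
      forall (c : 'I_K) (A : set (n.-tuple R)), measurable A ->
        P (C @^-1` [set c] `&` X @^-1` A) =
        (P (C @^-1` [set c]) * \int[mu]_(x in A) (f c x)%:E)%E].

End mixtures.

Definition to_row (x : Rn R n) : 'rV[R]_n := \row_i tnth (x : n.-tuple R) i.

Definition sym_posdef (S : 'M[R]_n) :=
  S^T = S /\ forall v : 'rV[R]_n, v != 0 -> 0 < (v *m S *m v^T) 0 0.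

Definition gaussian_density (m : 'rV[R]_n) (S : 'M[R]_n) : Rn R n -> R :=
  fun x => (Num.sqrt ((2 * pi) ^+ n * \det S))^-1 *
    expR (- ((to_row x - m) *m invmx S *m (to_row x - m)^T) 0 0 / 2).

Definition is_gaussian g :=
  exists m S, sym_posdef S /\ g = gaussian_density m S.

Definition laplace_density (m b : 'rV[R]_n) : Rn R n -> R :=
  fun x => \prod_(i < n)
    ((2 * b 0 i)^-1 * expR (- `|to_row x 0 i - m 0 i| / b 0 i)).

Definition is_factorized_laplacian g :=
  exists m b : 'rV[R]_n, (forall i, 0 < b 0 i) /\ g = laplace_density m b.

Definition is_uniform g :=
  exists A : set (Rn R n),
    [/\ measurable A, (0 < mu A)%E, (mu A < +oo)%E &
        g = fun x => (fine (mu A))^-1 * \1_A x].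

End entropies.

(* Main.v *)
(* The families: the Gaussian and Laplacian densities are [g = c * exp (- q)]
   with [q] homogeneous of degree [alpha] (2, resp. 1) about a point.  Since
   [g] integrates to 1, the scaling of Lebesgue measure under homotheties alone
   gives [\int c * exp (- t q) = t ^ (- n / alpha)] for all [t > 0].  At [t = 2]
   this is the collision entropy.  For the differential entropy, convexity of
   [exp] yields [t ^ (- n / alpha) >= 1 + (1 - t) L] with [L = \int q g], an
   equality at [t = 1]; comparing derivatives there, [L = n / alpha].

   Zero overlap: [\int f_c ^ 2 > 0] for a density, so the logarithm of
   [pi_c * z_(c,c)] splits. *)
Require Import Defs.
From mathcomp Require Import all_boot all_order all_algebra.
From mathcomp Require Import all_classical all_reals all_analysis.
From mathcomp Require Import measurable_realfun ring.
Import Order.TTheory GRing.Theory Num.Theory.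
Import numFieldNormedType.Exports.

Local Open Scope classical_set_scope.
Local Open Scope ring_scope.

(** * Scaling of Lebesgue measure under positive homotheties with translation *)

Definition image_measure {d1 d2 : measure_display} {T1 : measurableType d1}
    {T2 : measurableType d2} {R : realType} (mu : {measure set T1 -> \bar R})
    {phi : T1 -> T2} (mphi : measurable_fun setT phi) :
    {measure set T2 -> \bar R} :=
  measure_function_pushforward__canonical__measure_function_Measure mu mphi.

Section measure_affine.
Context {R : realType}.

Lemma measurable_affine1 (s b : R) :
  measurable_fun setT
    (fun x : measurableTypeR R => s * x + b : measurableTypeR R).
Proof. by apply: measurable_funD => //; apply: measurable_funM. Qed.

(** The image measure multiplied by [s] agrees with Lebesgue measure on half-open intervals, and
    these determine it. *)
Lemma lebesgue_measure_affine (s b : R) (A : set (measurableTypeR R)) :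
  0 < s -> measurable A ->
  lebesgue_measure ((fun x => s * x + b) @^-1` A) =
  ((s^-1)%:E * lebesgue_measure A)%E.
Proof.
move=> s0 mA.
pose s' := NngNum (ltW s0).
pose phi (x : measurableTypeR R) : measurableTypeR R := s * x + b.
have mphi : measurable_fun setT phi by exact: measurable_affine1.
have H : lebesgue_measure A = mscale s' (image_measure lebesgue_measure mphi) A.
  apply: lebesgue_measure_unique => //= _ [[x y]] _ <-.
  rewrite /mscale/= /pushforward/=.
  rewrite (_ : phi @^-1` _ = `](x - b) / s, (y - b) / s]%classic); last first.
    by apply/seteqP; split=> z /=; rewrite !in_itv/= /phi ltr_pdivrMr//
      ler_pdivlMr// ltrBlDr lerBrDr [z * s]mulrC.
  rewrite !lebesgue_measure_itv/= !lte_fin ltr_pM2r ?invr_gt0// ltrD2r.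
  case: ifPn; last by rewrite mule0.
  by move=> _; rewrite -EFinM; congr EFin; field; rewrite gt_eqF.
by rewrite H /mscale/= muleA -EFinM mulVf ?gt_eqF// mul1e.
Qed.

Definition affine {n : nat} (s : R) (b t : n.-tuple R) : n.-tuple R :=
  [tuple s * tnth t i + tnth b i | i < n].

Lemma measurable_affine {n : nat} (s : R) (b : n.-tuple R) :
  measurable_fun setT (affine s b).
Proof.
apply/measurable_fun_tnthP => i.
rewrite (_ : _ \o _ = fun t => s * tnth t i + tnth b i); last first.
  by apply/funext => t /=; rewrite tnth_mktuple.
apply: measurable_funD => //; apply: measurable_funM => //.
exact: measurable_tnth.
Qed.

(** By induction on [n]: read through [cons_pair], the map is a product of a one-dimensional and an
    [n]-dimensional affine map, and a product measure is determined by its values on rectangles. *)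
Lemma borel_lebesgue_affine (n : nat) (s : R) (b : n.-tuple R)
    (A : set (n.-tuple R)) : 0 < s -> measurable A ->
  borel_lebesgue R n (affine s b @^-1` A) =
  ((s^-1 ^+ n)%:E * borel_lebesgue R n A)%E.
Proof.
move=> s0; elim: n b A => [|n IH] b A mA.
  rewrite expr0 mul1e (_ : _ @^-1` _ = A)//.
  rewrite (_ : affine s b = id) ?preimage_id//; apply/funext => t.
  by rewrite (tuple0 (affine _ _ _)) (tuple0 t).
have c0 : 0 <= s ^+ n.+1 by rewrite exprn_ge0// ltW.
pose b' : n.-tuple R := [tuple of behead b].
pose psi (p : measurableTypeR R * n.-tuple R) :
    measurableTypeR R * n.-tuple R := (s * p.1 + thead b, affine s b' p.2).
have mpsi : measurable_fun setT psi.
  apply: measurable_fun_pair.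
    apply: (measurableT_comp (measurable_affine1 s (thead b))).
    exact: measurable_fst.
  by apply: (measurableT_comp (measurable_affine s b')); exact: measurable_snd.
(* The factor [s ^+ n.+1] offsets the factors [s^-1] and [s^-1 ^+ n] that the preimages of the two
   sides of a rectangle pick up. *)
pose m' := mscale (NngNum c0)
  (image_measure (lebesgue_measure \x borel_lebesgue R n)%E mpsi).
have E (B : set (measurableTypeR R * n.-tuple R)) : measurable B ->
    ((lebesgue_measure \x borel_lebesgue R n) B = m' B)%E.
  apply: product_measure_unique => A1 A2 mA1 mA2.
  transitivity ((s ^+ n.+1)%:E * (lebesgue_measure \x borel_lebesgue R n)%E
    (((fun x => (s * x + thead b)%R) @^-1` A1) `*` (affine s b' @^-1` A2)))%E => //.
  transitivity ((s ^+ n.+1)%:E * (((s^-1)%:E * lebesgue_measure A1) *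
      ((s^-1 ^+ n)%:E * borel_lebesgue R n A2)))%E.
    congr (_ * _)%E; rewrite product_measure1E.
    - by congr (_ * _)%E; [exact: lebesgue_measure_affine|exact: IH].
    - by rewrite -[X in measurable X]setTI; exact: measurable_affine1.
    - by rewrite -[X in measurable X]setTI; exact: measurable_affine.
  rewrite muleACA -EFinM -exprS (muleA (s ^+ n.+1)%:E) -EFinM.
  rewrite -exprMn mulfV ?gt_eqF// expr1n.
  exact: mul1e.
have mcA : measurable (@cons_pair R n @^-1` A).
  by rewrite -[X in measurable X]setTI; exact: measurable_cons_pair.
have -> : borel_lebesgue R n.+1 A = ((s ^+ n.+1)%:E *
    (lebesgue_measure \x borel_lebesgue R n)%E
      (psi @^-1` (@cons_pair R n @^-1` A)))%E.
  exact: E.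
rewrite muleA -EFinM -exprMn mulVf ?gt_eqF// expr1n mul1e.
suff psiE : @cons_pair R n \o psi = affine s b \o @cons_pair R n.
  by rewrite -[RHS]/((_ \x _)%E ((@cons_pair R n \o psi) @^-1` A)) psiE.
apply/funext => -[x t]; apply: eq_from_tnth => i.
rewrite /= /psi /cons_pair/= tnth_mktuple.
case: (unliftP ord0 i) => [j ->|->]; last by rewrite !tnth0.
rewrite !tnthS tnth_mktuple tnth_behead; congr (_ + tnth b _).
by apply: val_inj; rewrite /= inordK// ltnS.
Qed.

Lemma affineK (n : nat) (s : R) (b : n.-tuple R) : s != 0 ->
  cancel (affine s b) (affine s^-1 [tuple - (s^-1 * tnth b i) | i < n]).
Proof.
move=> s0 t; apply: eq_from_tnth => i.
by rewrite !tnth_mktuple mulrDr mulKf// addrK.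
Qed.

Lemma affineVK (n : nat) (s : R) (b : n.-tuple R) : s != 0 ->
  cancel (affine s^-1 [tuple - (s^-1 * tnth b i) | i < n]) (affine s b).
Proof.
move=> s0 t; apply: eq_from_tnth => i.
by rewrite !tnth_mktuple mulrDr mulrN !mulVKf// subrK.
Qed.

(** The preimages of a countable measurable cover of [A] cover the preimage of [A], each with its
    measure scaled; the bound follows by taking the infimum over covers. *)
Let outer_affine_le (n : nat) (s : R) (b : n.-tuple R) (A : set (n.-tuple R)) :
  0 < s ->
  ((borel_lebesgue R n)^*%mu (affine s b @^-1` A) <=
   (s^-1 ^+ n)%:E * (borel_lebesgue R n)^*%mu A)%E.
Proof.
move=> s0; have c0 : 0 < s ^+ n by rewrite exprn_gt0.
rewrite exprVn muleC lee_pdivlMr//; apply: le_ereal_inf_tmp => _ [B [mB AB] <-].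
rewrite -lee_pdivlMr//.
apply: ereal_inf_lbound; exists (fun k => affine s b @^-1` B k).
  split=> [k|t /AB[k _ Bk]]; last by exists k.
  by rewrite -[X in measurable X]setTI; exact: measurable_affine.
under eq_eseriesr do rewrite borel_lebesgue_affine//.
by rewrite nneseriesZl ?exprVn 1?muleC// => ? _; exact: measure_ge0.
Qed.

(** The reverse inequality is the one-sided bound for the inverse map, which is affine with slope
    [s^-1]. *)
Lemma outer_lebesgue_affine (n : nat) (s : R) (b : n.-tuple R)
    (A : set (n.-tuple R)) : 0 < s ->
  ((borel_lebesgue R n)^*%mu (affine s b @^-1` A) =
   (s^-1 ^+ n)%:E * (borel_lebesgue R n)^*%mu A)%E.
Proof.
move=> s0; apply/eqP; rewrite eq_le outer_affine_le//=.
have c0 : 0 < s ^+ n by rewrite exprn_gt0.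
rewrite exprVn muleC lee_pdivrMr// muleC.
have sV0 : 0 < s^-1 by rewrite invr_gt0.
have := @outer_affine_le n s^-1 [tuple - (s^-1 * tnth b i) | i < n]
  (affine s b @^-1` A) sV0.
rewrite invrK -comp_preimage (_ : _ \o _ = id) ?preimage_id//.
by apply/funext => t /=; rewrite affineVK ?gt_eqF.
Qed.

(** Measurable sets of [Rn] are those satisfying the Caratheodory criterion, so the criterion itself
    is transported: the map is a bijection, hence every test set is a preimage, and outer measures
    of preimages all scale by the same factor. *)
Lemma measurable_affine_Rn (n : nat) (s : R) (b : n.-tuple R) : 0 < s ->
  measurable_fun setT (affine s b : Rn R n -> Rn R n).
Proof.
move=> s0 _ A mA; rewrite setTI.
pose mu := (borel_lebesgue R n)^*%mu.
have mu0 Y : (0 <= mu Y)%E.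
  exact: (mu_ext_ge0 (measure_ge0 (borel_lebesgue R n))).
have cA : forall Y, (mu Y = mu (Y `&` A) + mu (Y `&` ~` A))%E := mA.
suff : forall X, (mu X = mu (X `&` affine s b @^-1` A) +
                      mu (X `&` ~` (affine s b @^-1` A)))%E by [].
move=> X; have [Y ->] : exists Y, X = affine s b @^-1` Y.
  exists (affine s^-1 [tuple - (s^-1 * tnth b i) | i < n] @^-1` X).
  rewrite -comp_preimage (_ : _ \o _ = id) ?preimage_id//.
  by apply/funext => t /=; rewrite affineK ?gt_eqF.
have muE Z : mu (affine s b @^-1` Z) = ((s^-1 ^+ n)%:E * mu Z)%E.
  exact: outer_lebesgue_affine.
(* Rewriting with [cA] diverges: unification unfolds the outer measure. *)
apply: (etrans (muE Y)); apply: (etrans (congr1 (mule _) (cA Y))).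
apply: (etrans (ge0_muleDr _ _ _)); try exact: mu0.
exact: esym (congr2 adde (muE (Y `&` A)) (muE (Y `&` ~` A))).
Qed.

Lemma ge0_integral_lebesgue_affine (n : nat) (s : R) (b : n.-tuple R)
    (g : Rn R n -> \bar R) : 0 < s -> measurable_fun setT g ->
  (forall x, 0 <= g x)%E ->
  (\int[lebesgue R n]_x g (affine s b x) =
   (s^-1 ^+ n)%:E * \int[lebesgue R n]_x g x)%E.
Proof.
move=> s0 mg g0.
have c0 : 0 <= s^-1 ^+ n by rewrite exprn_ge0// invr_ge0 ltW.
have mA := @measurable_affine_Rn n s b s0.
rewrite -(@ge0_integral_mscale _ _ _ (lebesgue R n) setT measurableT (NngNum c0))//.
rewrite -(@ge0_integral_pushforward _ _ _ _ _ _ mA _ setT)//.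
apply: eq_measure_integral => A _ _; exact: outer_lebesgue_affine.
Qed.

End measure_affine.

(** * Binary logarithms and the comparison of derivatives *)

Lemma ln2_neq0 (R : realType) : ln 2 != 0 :> R.
Proof. by rewrite gt_eqF// ln_gt0// ltr1n. Qed.

Lemma log2M (R : realType) (x y : R) : 0 < x -> 0 < y ->
  log2 (x * y) = log2 x + log2 y.
Proof. by move=> x0 y0; rewrite /log2 lnM ?posrE// mulrDl. Qed.

Lemma log2_e_half (R : realType) : log2 (expR 1 / 2) = (ln 2)^-1 - 1 :> R.
Proof.
rewrite /log2 ln_div ?posrE ?expR_gt0// expRK mulrBl mul1r divff//.
exact: ln2_neq0.
Qed.

(** The difference [h] of the two sides is nonnegative and vanishes at [u = 0], so its derivative
    there, [L - a], is zero. *)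
Lemma expR_tangent_slope (R : realType) (a L : R) :
  (forall u, 1 + (1 - expR u) * L <= expR (- (a * u))) -> L = a.
Proof.
move=> H; pose h (u : R) := expR (- (a * u)) - (1 + (1 - expR u) * L).
have dh (u : R) : is_derive u (1 : R) h (- a * expR (- (a * u)) + expR u * L).
  by rewrite /h; apply: is_derive_eq; rewrite /GRing.scale/=; ring.
have : is_derive (0 : R) (1 : R) h 0.
  apply: (@derive1_at_min _ h (-1) 1) => //.
  - by rewrite in_itv/= ltrN10 ltr01.
  - move=> t _; rewrite /h mulr0 oppr0 expR0 subrr mul0r addr0 subrr.
    by rewrite subr_ge0.
move=> dh0; have := @derive_val _ _ _ _ _ _ _ dh0.
have -> := @derive_val _ _ _ _ _ _ _ (dh 0).
by rewrite mulr0 oppr0 expR0 mulr1 mul1r addrC => /eqP; rewrite subr_eq0 => /eqP.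
Qed.

(** * The gap of a density with homogeneous exponent *)

Section gap.
Context {R : realType} {n : nat}.
Local Notation mu := (lebesgue R n).

Lemma integrable_density (g : Rn R n -> R) : is_density g ->
  mu.-integrable setT (EFin \o g).
Proof.
move=> [mg g0 g1]; apply/integrableP; split; first exact/measurable_EFinP.
under eq_integral do rewrite /= ger0_norm//.
by rewrite g1 ltry.
Qed.

Lemma integrable_scale (k : R) (h : Rn R n -> R) :
  mu.-integrable setT (EFin \o h) ->
  mu.-integrable setT (EFin \o (fun x => k * h x)).
Proof. exact: (@integrableZl _ _ _ mu _ measurableT k (EFin \o h)). Qed.

(** With [a = n / alpha], the entropy is [a / ln 2 - log2 c] and the collision entropy is
    [a - log2 c], so the normalising constant cancels. The translation [b] may depend on [s], since
    the homothety has to fix the centre of [q]. *)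
Lemma gap_homogeneous (alpha : nat) (c : R) (q : Rn R n -> R) :
  (0 < alpha)%N -> 0 <= c ->
  (forall s, 0 < s -> exists b, forall x, q (affine s b x) = s ^+ alpha * q x) ->
  let g := fun x => c * expR (- q x) in
  is_density g -> has_finite_entropy g ->
  gap g = n%:R / alpha%:R * log2 (expR 1 / 2).
Proof.
move=> alpha0 c_ge0 qhom g dg hg; have [mg g0 g1] := dg.
have gE x : g x = c * expR (- q x) by [].
(* With [g] transparent, [RintegralZl] would also extract [c] from it. *)
clearbody g.
have c0 : 0 < c.
  rewrite lt0r c_ge0 andbT; apply/negP => /eqP c0; move: g1.
  rewrite (eq_integral (cst 0%E)); last by move=> x _; rewrite gE c0 mul0r.
  by rewrite integral0 => -[]/eqP; rewrite eq_sym oner_eq0.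
set a := n%:R / alpha%:R.
have lng x : ln (g x) = ln c - q x by rewrite gE lnM ?posrE ?expR_gt0// expRK.
(* Measurability of [q] is recovered from that of [g] through [q = ln c - ln g]. *)
have mq : measurable_fun setT q.
  rewrite (_ : q = fun x => ln c - ln (g x)).
    by apply: measurable_funB => //; exact: (measurableT_comp (@measurable_ln R)).
  by apply/funext => x; rewrite lng subKr.
have mJ u : measurable_fun setT (fun x => c * expR (- (expR u * q x))).
  apply: measurable_funM => //; apply: (measurableT_comp (@measurable_expR R)).
  apply: measurableT_comp => //; exact: measurable_funM.
(* The parameter [t] of the header is written [expR u]. *)
have J u : (\int[mu]_x (c * expR (- (expR u * q x)))%:E =
    (expR (- (a * u)))%:E)%E.
  (* For this [s], composing [g] with the homothety multiplies [q] by [expR u], while the integral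
     picks up [s^-1 ^+ n], which is [expR (- (a * u))]. *)
  pose s := expR (u / alpha%:R).
  have sa : s ^+ alpha = expR u.
    by rewrite /s -expRM_natl mulrC divfK// pnatr_eq0 -lt0n.
  have [b qb] := qhom s (expR_gt0 _).
  have := @ge0_integral_lebesgue_affine _ _ _ b (EFin \o g)
    (expR_gt0 (u / alpha%:R)).
  rewrite /= g1 mule1 => gJ.
  transitivity (\int[mu]_x (g (affine s b x))%:E)%E.
    by apply: eq_integral => x _; rewrite gE qb sa.
  rewrite gJ; [|exact/measurable_EFinP|by move=> x; rewrite lee_fin].
  rewrite -expRN -expRM_natl; congr (expR _)%:E.
  by rewrite /a mulrN mulrCA mulrAC mulrA [n%:R * u]mulrC -!mulrA.
have ig := integrable_density _ dg.
(* Finite entropy enters here: [q * g] is a linear combination of [g] and [g * log2 g]. *)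
have iqg : mu.-integrable setT (EFin \o (fun x => q x * g x)).
  rewrite (_ : _ \o _ = fun x => ((ln c)%:E * (g x)%:E -
      (ln 2)%:E * (g x * log2 (g x))%:E)%E).
    by apply: integrableB => //; apply: integrableZl.
  apply/funext => x /=; rewrite -!EFinM -EFinB; congr EFin.
  by rewrite /log2 lng; field; exact: ln2_neq0.
set L := \int[mu]_x (q x * g x).
have intg : \int[mu]_x g x = 1 by rewrite /Rintegral g1.
have La : L = a.
  apply: expR_tangent_slope => u.
  have -> : expR (- (a * u)) = \int[mu]_x (c * expR (- (expR u * q x))).
    by rewrite /Rintegral J.
  have -> : 1 + (1 - expR u) * L =
      \int[mu]_x (g x + (1 - expR u) * (q x * g x)).
    rewrite RintegralD//; last exact: integrable_scale.
    by rewrite RintegralZl// intg.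
  apply: le_Rintegral => //.
  - exact: (integrableD measurableT ig (integrable_scale (1 - expR u) _ iqg)).
  - apply/integrableP; split; first exact/measurable_EFinP.
    under eq_integral do rewrite /= ger0_norm ?mulr_ge0 ?expR_ge0//.
    by rewrite J ltry.
  - move=> x _; rewrite gE.
    (* Pointwise this is [expR y >= 1 + y] at [y = (1 - expR u) * q x], multiplied by [g x]. *)
    have -> : - (expR u * q x) = - q x + (1 - expR u) * q x by ring.
    rewrite expRD mulrA -subr_ge0.
    set y := (1 - _) * q x.
    rewrite (_ : _ - _ = c * expR (- q x) * (expR y - (1 + y))); last first.
      by rewrite /y; ring.
    by rewrite mulr_ge0// ?subr_ge0 ?expR_ge1Dx// mulr_ge0 ?expR_ge0.
rewrite /gap; have -> : entropy g = a / ln 2 - log2 c.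
  rewrite /entropy.
  have -> : \int[mu]_x (g x * log2 (g x)) =
    \int[mu]_x (log2 c * g x - (ln 2)^-1 * (q x * g x)).
    by apply: eq_Rintegral => x _; rewrite /log2 lng; ring.
  rewrite RintegralB//; [|exact: integrable_scale..].
  by rewrite !RintegralZl// intg mulr1 -/L La opprB mulrC.
have -> : renyi2 g = a - log2 c.
  rewrite /renyi2.
  (* Squaring [g] doubles the exponent, so the integral is [c] times the one computed in [J] at
     [u = ln 2]. *)
  have -> : \int[mu]_x (g x) ^+ 2 = c * expR (- (a * ln 2)).
    rewrite -[expR (- _)]/(fine (expR (- (a * ln 2)))%:E) -J.
    rewrite -/(Rintegral _ _ _) -RintegralZl//.
      apply: eq_Rintegral => x _; rewrite gE lnK ?posrE//.
      by rewrite mulr2n mulrDl mul1r opprD expRD; ring.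
    apply/integrableP; split; first exact/measurable_EFinP.
    under eq_integral do rewrite /= ger0_norm ?mulr_ge0 ?expR_ge0//.
    by rewrite J ltry.
  by rewrite log2M ?expR_gt0// /log2 expRK mulNr mulfK ?ln2_neq0//; ring.
by rewrite log2_e_half; ring.
Qed.

End gap.

(** * Gaussian, Laplacian and uniform densities *)

Section families.
Context (R : realType) (n : nat).
Local Notation mu := (lebesgue R n).

(** Translation part of the homothety of ratio [s] that fixes [m]. *)
Definition fix_tuple (s : R) (m : 'rV[R]_n) : n.-tuple R :=
  [tuple (1 - s) * m 0 i | i < n].

Lemma affine_fix_tuple (s : R) (m : 'rV[R]_n) (x : Rn R n) :
  to_row (affine s (fix_tuple s m) x) - m = s *: (to_row x - m).
Proof. by apply/rowP => i; rewrite !mxE !tnth_mktuple; ring. Qed.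

(** The exponent is a quadratic form in [x - m], hence homogeneous of degree 2 about [m]. *)
Lemma gap_gaussian (g : Rn R n -> R) :
  is_gaussian g -> is_density g -> has_finite_entropy g ->
  gap g = n%:R / 2 * log2 (expR 1 / 2).
Proof.
move=> [m [S [_ ->]]] dg hg.
pose q (x : Rn R n) := ((to_row x - m) *m invmx S *m (to_row x - m)^T) 0 0 / 2.
have E : gaussian_density m S =
    fun x => (Num.sqrt ((2 * pi) ^+ n * \det S))^-1 * expR (- q x).
  by apply/funext => x; rewrite /gaussian_density /q mulNr.
rewrite E in dg hg *; apply: (@gap_homogeneous _ _ 2 _ q) dg hg => //.
move=> s s0; exists (fix_tuple s m) => x.
by rewrite /q affine_fix_tuple linearZ -!scalemxAl -!scalemxAr !mxE; ring.
Qed.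

(** Once the product of exponentials is merged into the exponential of a sum, the exponent is
    homogeneous of degree 1 about [m] for positive ratios. *)
Lemma gap_laplace (g : Rn R n -> R) :
  is_factorized_laplacian g -> is_density g -> has_finite_entropy g ->
  gap g = n%:R * log2 (expR 1 / 2).
Proof.
move=> [m [b [b0 ->]]] dg hg.
pose q (x : Rn R n) := \sum_(i < n) `|(to_row x - m) 0 i| / b 0 i.
have E : laplace_density m b =
    fun x => (\prod_(i < n) (2 * b 0 i)^-1) * expR (- q x).
  apply/funext => x; rewrite /laplace_density big_split/= -sumrN expR_sum.
  by congr (_ * _); apply: eq_bigr => i _; rewrite !mxE mulNr.
rewrite E in dg hg *.
rewrite -[n%:R]divr1; apply: (@gap_homogeneous _ _ 1 _ q) dg hg => //.
  by apply: prodr_ge0 => i _; rewrite invr_ge0 mulr_ge0// ltW.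
move=> s s0; exists (fix_tuple s m) => x; rewrite expr1 /q mulr_sumr.
by apply: eq_bigr => i _; rewrite affine_fix_tuple mxE normrM gtr0_norm// mulrA.
Qed.

(** Since [g] only takes the values 0 and [1 / mu A], both [g * log2 g] and [g ^+ 2] are constant
    multiples of [g], with constants [log2 (1 / mu A)] and [1 / mu A]. *)
Lemma gap_uniform (g : Rn R n -> R) : is_uniform g -> is_density g -> gap g = 0.
Proof.
move=> [A [mA A0 Aoo gE]] dg.
have a0 : 0 < fine (mu A) by rewrite fine_gt0// A0.
have ig := integrable_density _ dg.
have intg : \int[mu]_x g x = 1 by case: dg => _ _ g1; rewrite /Rintegral g1.
have -> : gap g =
    - (\int[mu]_x (g x * log2 (g x))) + log2 (\int[mu]_x (g x ^+ 2)).
  by rewrite /gap /entropy /renyi2 opprK.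
have -> : \int[mu]_x (g x * log2 (g x)) =
    \int[mu]_x (log2 (fine (mu A))^-1 * g x).
  apply: eq_Rintegral => x _; rewrite gE indicE.
  by case: (x \in A); rewrite ?mulr0 ?mulr1 ?mul0r// mulrC.
have -> : \int[mu]_x (g x ^+ 2) = \int[mu]_x ((fine (mu A))^-1 * g x).
  apply: eq_Rintegral => x _; rewrite gE indicE.
  by case: (x \in A); rewrite ?mulr0 ?mulr1 ?expr0n.
by rewrite !RintegralZl// intg !mulr1 addNr.
Qed.

End families.

(** * Density of the mixture and the two extreme overlap regimes *)

Section mixtures.
Context (R : realType) (n K : nat).
Local Notation mu := (lebesgue R n).
Context (w : 'I_K -> R) (f : 'I_K -> Rn R n -> R).
Context (w0 : forall c, 0 < w c) (w1 : \sum_(c < K) w c = 1).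
Context (df : forall c, is_density (f c)).

Lemma integral_mixture (A : set (Rn R n)) : measurable A ->
  (\int[mu]_(x in A) (mixture w f x)%:E =
   \sum_(c < K) (w c)%:E * \int[mu]_(x in A) (f c x)%:E)%E.
Proof.
move=> mA; under eq_integral do rewrite /mixture -sumEFin.
have mf c : measurable_fun A (f c) by apply: measurable_funTS; case: (df c).
rewrite ge0_integral_sum//.
- apply: eq_bigr => c _; under eq_integral do rewrite EFinM.
  rewrite ge0_integralZl_EFin ?ltW//; last exact/measurable_EFinP.
  by move=> x _; rewrite lee_fin; case: (df c).
- by move=> c; apply/measurable_EFinP; apply: measurable_funM => //; exact: mf.
- by move=> c x _; apply: mulr_ge0; [exact: ltW|case: (df c)].
Qed.

Lemma is_density_mixture : is_density (mixture w f).
Proof.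
split.
- apply: measurable_sum => c; apply: measurable_funM => //.
  by case: (df c).
- by move=> x; apply: sumr_ge0 => c _; apply: mulr_ge0; [exact: ltW|case: (df c)].
- rewrite integral_mixture//.
  under eq_bigr => c _ do (case: (df c) => _ _ ->; rewrite mule1).
  by rewrite sumEFin w1.
Qed.

(** The fibres of [C] split the event into finitely many disjoint pieces, each given by its
    conditional density. *)
Lemma mixture_model_density (d : measure_display) (Omega : measurableType d)
    (P : probability Omega R) (C : Omega -> 'I_K) (X : {RV P >-> n.-tuple R}) :
  mixture_model C X w f -> forall A : set (n.-tuple R), measurable A ->
  P (X @^-1` A) = (\int[mu]_(x in A) (mixture w f x)%:E)%E.
Proof.
move=> [mC PC PX] A mA.
have mXA : measurable (X @^-1` A).
  by rewrite -[X in measurable X]setTI; exact: (@measurable_funPT _ _ _ _ X).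
rewrite integral_mixture; last exact: measurable_Borel_Rn.
rewrite (_ : X @^-1` A =
    \big[setU/set0]_(c < K) (C @^-1` [set c] `&` X @^-1` A)).
  rewrite measure_bigsetU_ord.
  - by apply: eq_bigr => c _; rewrite -PC; exact: PX.
  - by move=> c; apply: measurableI.
  - by move=> c e _ _ [x [[/= <- _] [/= <- _]]].
rewrite -bigcup_seq; apply/seteqP; split => [x Ax|x [c _ []]//].
by exists (C x) => //=; exact: mem_index_enum.
Qed.

Lemma overlap_self (c : 'I_K) : overlap f c c = \int[mu]_x (f c x ^+ 2).
Proof. by apply: eq_Rintegral => x _; rewrite expr2. Qed.

(** If the integral of the square vanished, [f c] would be zero almost everywhere, against its total
    mass 1. *)
Lemma overlap_self_gt0 (c : 'I_K) :
  is_square_integrable (f c) -> 0 < overlap f c c.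
Proof.
move=> sf; have [mf f0 f1] := df c.
rewrite overlap_self lt0r Rintegral_ge0 ?andbT; last by move=> x _; rewrite sqr_ge0.
apply/eqP => I0.
(* As [fine] sends infinity to 0, square integrability is what lets the real equality [I0] lift to
   the extended integral. *)
have I0E : (\int[mu]_x (f c x ^+ 2)%:E = 0)%E.
  rewrite -[LHS]fineK; first by rewrite -/(Rintegral _ _ _) I0.
  by rewrite ge0_fin_numE// integral_ge0// => x _; rewrite lee_fin sqr_ge0.
have mf2 : measurable_fun setT (fun x => (f c x ^+ 2)%:E).
  by apply/measurable_EFinP; exact: measurable_funX.
have ae : ae_eq mu setT (fun x => (f c x ^+ 2)%:E) (cst 0%E).
  apply/(ae_eq_integral_abs mu measurableT mf2); rewrite -I0E.
  by apply: eq_integral => x _; rewrite gee0_abs// lee_fin sqr_ge0.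
have : (\int[mu]_x (f c x)%:E = 0)%E.
  rewrite -(integral0 mu setT); apply: ae_eq_integral => //.
    exact/measurable_EFinP.
  apply: filterS ae => x /(_ I)[]/eqP; rewrite sqrf_eq0 => /eqP fx _.
  by rewrite fx.
by rewrite f1 => -[]/eqP; rewrite oner_eq0.
Qed.

(** Every overlap is the collision integral of [g] and the weights sum to 1, so [overlap_entropy] is
    [renyi2 g], to which the gap adds back [entropy g - renyi2 g]. *)
Lemma entropy_estimate_same (g : Rn R n -> R) : (forall c, f c = g) ->
  entropy_estimate w f = entropy g /\ entropy g = entropy (mixture w f).
Proof.
move=> fg; split; last first.
  congr entropy; apply/funext => x; rewrite /mixture.
  by under eq_bigr do rewrite fg; rewrite -mulr_suml w1 mul1r.
rewrite /entropy_estimate /overlap_entropy /mean_gap.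
have E c : \sum_(d < K) w d * overlap f c d = \int[mu]_x (g x ^+ 2).
  transitivity (\sum_(d < K) w d * \int[mu]_x (g x ^+ 2)); last first.
    by rewrite -mulr_suml w1 mul1r.
  apply: eq_bigr => e _; congr (_ * _); apply: eq_Rintegral => x _.
  by rewrite !fg expr2.
under eq_bigr do rewrite E; under [X in _ + X]eq_bigr do rewrite fg.
by rewrite -!mulr_suml w1 !mul1r /gap /renyi2 addrCA subrr addr0.
Qed.

(** Only the diagonal overlap survives in each inner sum; its logarithm splits into [log2 (w c)] and
    [- renyi2 (f c)], and the latter cancels against the gap. *)
Lemma entropy_estimate_disjoint :
  (forall c, is_square_integrable (f c)) ->
  (forall c e, c != e -> overlap f c e = 0) ->
  entropy_estimate w f = cond_entropy w f + label_entropy w.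
Proof.
move=> sf f0; rewrite /entropy_estimate /overlap_entropy /mean_gap.
rewrite /cond_entropy /label_entropy -!sumrN -!big_split/=.
apply: eq_bigr => c _.
rewrite (bigD1 c)//= big1 ?addr0; last by move=> e ec; rewrite f0 ?mulr0// eq_sym.
by rewrite log2M ?overlap_self_gt0// overlap_self /gap /renyi2; ring.
Qed.

End mixtures.

Theorem lemma4 (R : realType) (n K : nat)
    (w : 'I_K -> R) (f : 'I_K -> Rn R n -> R)
    (F : 'I_K -> set (Rn R n -> R))
    (d : measure_display) (Omega : measurableType d)
    (P : probability Omega R)
    (C : Omega -> 'I_K) (X : {RV P >-> n.-tuple R}) :
  (1 <= n)%N -> (1 <= K)%N ->
  (forall c, 0 < w c) -> \sum_(c < K) w c = 1 ->
  (forall c, is_density (f c)) ->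
  (forall c, is_square_integrable (f c)) ->
  (forall c, has_finite_entropy (f c)) ->
  mixture_model C X w f ->
  (forall c, constant_gap_family (F c) /\ F c (f c)) ->
  [/\ (* X has density p_X *)
      is_density (mixture w f) /\
      (forall A : set (n.-tuple R), measurable A ->
         P (X @^-1` A) = (\int[lebesgue R n]_(x in A) (mixture w f x)%:E)%E),
      (* complete overlap *)
      (forall g : Rn R n -> R, (forall c, f c = g) ->
         entropy_estimate w f = entropy g /\
         entropy g = entropy (mixture w f)),
      (* zero overlap *)
      ((forall c e, c != e -> overlap f c e = 0) ->
         entropy_estimate w f = cond_entropy w f + label_entropy w) &
      (* family constants *)
      (forall c,
         [/\ is_gaussian (f c) ->
               gap (f c) = n%:R / 2 * log2 (expR 1 / 2),
             is_factorized_laplacian (f c) ->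
               gap (f c) = n%:R * log2 (expR 1 / 2) &
             is_uniform (f c) -> gap (f c) = 0])].
Proof.
move=> _ _ w0 w1 df sf hf CX _; split.
- by split; [exact: is_density_mixture|exact: mixture_model_density CX].
- exact: entropy_estimate_same.
- exact: entropy_estimate_disjoint.
- by move=> c; split => fc;
    [exact: gap_gaussian|exact: gap_laplace|exact: gap_uniform].
Qed.
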